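(* Every locally-transitive tournament has a unique minimal $\tau$-retentive set (i.e., Schwartz's Conjecture holds in all locally-transitive tournaments).
   Context: A tournament $T$ consists of a finite nonempty vertex set $V(T)$ and an asymmetric, complete binary relation $\succ$ on $V(T)$ ($x$ dominates $y$ if $x\succ y$). For $v\in V(T)$ let $N^-_T(v)=\{u: u\succ v\}$ and $N^+_T(v)=\{u: v\succ u\}$; for $B\subseteq V(T)$, $T[B]$ is the induced subtournament. A tournament is transitive if its relation is transitive. $T$ is locally-transitive if for every vertex $v$ both $T[N^+_T(v)]$ and $T[N^-_T(v)]$ are transitive. The tournament equilibrium set $\tau$ is defined recursively: a nonempty $A\subseteq V(T)$ is $\tau$-retentive if for every $v\in A$ with $N^-_T(v)\neq\emptyset$, $\tau(T[N^-_T(v)])\subseteq A$; $A$ is a minimal $\tau$-retentive set if no $\tau$-retentive set of $T$ is a proper subset of $A$; $\tau(T)$ is the union of all minimal $\tau$-retentive sets of $T$. *)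

(* Defs.v *)
From mathcomp Require Import all_boot.

Set Implicit Arguments.
Unset Strict Implicit.
Unset Printing Implicit Defensive.

Section Tournament.

Variables (V : finType) (dom : rel V).

Definition tournament : Prop :=
  [/\ 0 < #|V|,
      forall x y, dom x y -> ~~ dom y x
    & forall x y, x != y -> dom x y || dom y x].

(* The subtournament T[B] is represented by its vertex set B : {set V}, so the
   two definitions below are the neighbourhoods of v in T[B]. *)
Definition inN (B : {set V}) (v : V) : {set V} := [set u in B | dom u v].
Definition outN (B : {set V}) (v : V) : {set V} := [set u in B | dom v u].

Definition transitive_on (B : {set V}) : Prop := {in B & &, transitive dom}.

Definition locally_transitive : Prop :=
  forall v, transitive_on (outN [set: V] v) /\ transitive_on (inN [set: V] v).

(* A is an S-retentive set of T[B], where S B' plays the role of S(T[B']) for a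
   tournament solution S. *)
Definition retentive_wrt (S : {set V} -> {set V}) (B A : {set V}) : bool :=
  [&& A != set0, A \subset B &
      [forall v in A, (inN B v != set0) ==> (S (inN B v) \subset A)]].

(* The recursion defining tau strictly decreases #|B|, which therefore serves as
   fuel; [tauE] is the intended defining equation. *)
Fixpoint tau_rec (n : nat) (B : {set V}) : {set V} :=
  if n is m.+1 then
    \bigcup_(A : {set V} | minset (retentive_wrt (tau_rec m) B) A) A
  else set0.

Definition tau (B : {set V}) : {set V} := tau_rec #|B| B.

Definition retentive (B A : {set V}) : bool := retentive_wrt tau B A.

Definition minimal_retentive (B A : {set V}) : bool := minset (retentive B) A.

Lemma retentive_wrt_ext (S S' : {set V} -> {set V}) (B : {set V}) :
    (forall v, v \in B -> S (inN B v) = S' (inN B v)) ->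
  retentive_wrt S B =1 retentive_wrt S' B.
Proof.
move=> eqS A; rewrite /retentive_wrt; congr (_ && _).
case: (boolP (A \subset B)) => //= sAB; apply: eq_forallb => v.
by case: (boolP (v \in A)) => //= /(subsetP sAB) /eqS ->.
Qed.

Lemma card_inN (B : {set V}) (v : V) :
  tournament -> v \in B -> #|inN B v| < #|B|.
Proof.
case=> _ asym _ vB; apply: proper_card; apply/properP; split.
  by apply/subsetP => u; rewrite inE => /andP[].
by exists v; rewrite // inE vB /=; apply/negP => vv; have := asym _ _ vv; rewrite vv.
Qed.

Lemma tau_rec_set0 (n : nat) : tau_rec n set0 = set0.
Proof.
case: n => //= n; apply: big1 => A /minsetp /and3P[A0 sA0 _].
by move: A0; rewrite -subset0 sA0.
Qed.

Lemma tau_rec_enough (n m : nat) (B : {set V}) :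
  tournament -> #|B| <= n -> #|B| <= m -> tau_rec n B = tau_rec m B.
Proof.
move=> tT; elim: n m B => [|n IHn] [|m] B Bn Bm;
  try by [move: Bn; rewrite leqn0 cards_eq0 => /eqP->; rewrite !tau_rec_set0
         |move: Bm; rewrite leqn0 cards_eq0 => /eqP->; rewrite !tau_rec_set0].
rewrite /=; apply: eq_bigl => A; apply: minset_eq => {}A.
apply: retentive_wrt_ext => v vB; have lt_v := card_inN tT vB.
by apply: IHn; rewrite -ltnS; apply: leq_trans lt_v _.
Qed.

Lemma tauE (B : {set V}) :
  tournament -> tau B = \bigcup_(A : {set V} | minimal_retentive B A) A.
Proof.
move=> tT; rewrite /tau (@tau_rec_enough _ #|B|.+1) //=.
apply: eq_bigl => A; apply: minset_eq => {}A.
apply: retentive_wrt_ext => v vB.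
by apply: tau_rec_enough => //; apply: ltnW; apply: card_inN.
Qed.

End Tournament.

(* Main.v *)
Require Import Defs.
From mathcomp Require Import all_boot.

Set Implicit Arguments.
Unset Strict Implicit.
Unset Printing Implicit Defensive.

(** Since every in-neighbourhood is transitive, [tau] maps a nonempty
    in-neighbourhood of [v] to its source [s v], so a minimal retentive set [A]
    satisfies [s @: A = A], and two distinct ones are disjoint. If [A] and [B]
    are two such sets and [v] in [A] dominates [b] in [B], then [s (s v)] lies
    strictly between them: it is dominated by [v] and dominates [b]. In
    particular the sink of the transitive set of those elements of [A] that
    dominate [b] is not a sink. *)

Section Sources.

Variables (V : finType) (dom : rel V).
Hypothesis tournament_dom : tournament dom.

Let dom_asym x y : dom x y -> ~~ dom y x.
Proof. by case: tournament_dom => _ asym _; apply: asym. Qed.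

Let dom_total x y : x != y -> dom x y || dom y x.
Proof. by case: tournament_dom => _ _; apply. Qed.

Let domxx x : dom x x = false.
Proof. by apply/negP => xx; have := dom_asym xx; rewrite xx. Qed.

(** Out-degree inside a transitive set strictly drops along [dom], so its maximiser is a source and
    its minimiser a sink. *)
Lemma outN_proper (X : {set V}) (x y : V) :
  transitive_on dom X -> x \in X -> y \in X -> dom x y ->
  outN dom X y \proper outN dom X x.
Proof.
move=> trX xX yX xy; apply/properP; split.
  apply/subsetP => u; rewrite !inE => /andP[uX yu]; rewrite uX.
  exact: trX yX xX uX xy yu.
by exists y; rewrite inE yX // domxx.
Qed.

Lemma transitive_on_source (X : {set V}) :
  transitive_on dom X -> X != set0 ->
  exists2 x, x \in X & {in X, forall u, u != x -> dom x u}.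
Proof.
move=> trX /set0Pn[x0 x0X].
case: (arg_maxnP (fun x => #|outN dom X x|) x0X) => x xX x_max.
exists x => // u uX ux; case/orP: (dom_total ux) => // ux'.
have := proper_card (outN_proper trX uX xX ux').
by rewrite ltnNge; move: (x_max u uX) => /= ->.
Qed.

Lemma transitive_on_sink (X : {set V}) :
  transitive_on dom X -> X != set0 ->
  exists2 x, x \in X & {in X, forall u, ~~ dom x u}.
Proof.
move=> trX /set0Pn[x0 x0X].
case: (arg_minnP (fun x => #|outN dom X x|) x0X) => x xX x_min.
exists x => // u uX; apply/negP => xu.
have := proper_card (outN_proper trX xX uX xu).
by rewrite ltnNge; move: (x_min u uX) => /= ->.
Qed.

(** No vertex of [X] dominates [x], so [[set x]] is retentive. Conversely, [x] is the source of the
    in-neighbourhood of any other [v] in [X]; by induction on the size of [X] that in-neighbourhood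
    has [tau] equal to [[set x]], so every retentive set contains [x]. *)
Lemma tau_source (X : {set V}) (x : V) :
  x \in X -> {in X, forall u, u != x -> dom x u} -> tau dom X = [set x].
Proof.
elim: {X}_.+1 {-2}X (ltnSn #|X|) => // n IHn X ltXn xX x_src.
have in_x0 : inN dom X x = set0.
  apply/setP => u; rewrite !inE; apply/negP => /andP[uX ux].
  have [eq_ux | neq_ux] := eqVneq u x; first by rewrite eq_ux domxx in ux.
  by have := dom_asym ux; rewrite x_src.
have ret_x : retentive dom X [set x].
  apply/and3P; split; first by apply/set0Pn; exists x; rewrite set11.
    by rewrite sub1set.
  by apply/forall_inP => v /set1P->; rewrite in_x0 eqxx.
have x_in_ret A : retentive dom X A -> x \in A.
  case/and3P=> /set0Pn[v vA] /subsetP sAX /forall_inP retA.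
  have [<- // | neq_vx] := eqVneq v x; have vX := sAX v vA.
  have x_in_v : x \in inN dom X v by rewrite inE xX x_src.
  have tau_v : tau dom (inN dom X v) = [set x].
    apply: IHn => //; first exact: leq_trans (card_inN tournament_dom vX) _.
    by move=> u; rewrite inE => /andP[uX _]; apply: x_src.
  have := retA v vA; rewrite tau_v sub1set => /implyP; apply.
  by apply/set0Pn; exists x.
rewrite tauE //; rewrite (big_pred1 [set x]) // => A /=.
apply/idP/eqP => [/minsetP[retA minA] | ->].
  by apply/esym/minA => //; rewrite sub1set x_in_ret.
apply/minsetP; split=> // B retB sBx.
by apply/eqP; rewrite eqEsubset sBx sub1set x_in_ret.
Qed.

Lemma retentive_setI (X A B : {set V}) :
  retentive dom X A -> retentive dom X B -> A :&: B != set0 ->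
  retentive dom X (A :&: B).
Proof.
move=> /and3P[_ sAX /forall_inP retA] /and3P[_ _ /forall_inP retB] AB0.
apply/and3P; split=> //; first exact: subset_trans (subsetIl _ _) sAX.
apply/forall_inP => v /setIP[vA vB]; apply/implyP => v0.
by rewrite subsetI (implyP (retA v vA)) // (implyP (retB v vB)).
Qed.

Hypothesis locally_transitive_dom : locally_transitive dom.

Let inv (v : V) := inN dom [set: V] v.

(** The default [v] makes a vertex without in-neighbours a fixed point, so that retentive sets
    become exactly the nonempty sets closed under [in_source]. *)
Definition in_source (v : V) : V :=
  odflt v [pick u in inv v | [forall w in inv v, (w != u) ==> dom u w]].

Local Notation s := in_source.

Lemma in_sourceP (v u : V) :
  dom u v -> dom (s v) v /\ {in inv v, forall w, w != s v -> dom (s v) w}.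
Proof.
move=> uv; have inv0 : inv v != set0.
  by apply/set0Pn; exists u; rewrite !inE.
rewrite /in_source; case: pickP => [x /andP[xv /forall_inP x_src] | no_src] /=.
  split; first by move: xv; rewrite !inE.
  by move=> w wv; apply: (implyP (x_src w wv)).
have [x xv x_src] := transitive_on_source (locally_transitive_dom v).2 inv0.
have := no_src x; rewrite /= xv /= => /negbT/negP[].
by apply/forall_inP => w wv; apply/implyP; apply: x_src.
Qed.

Lemma in_source_dom (v u : V) : dom u v -> dom (s v) v.
Proof. by case/in_sourceP. Qed.

Lemma in_source_max (v u : V) : dom u v -> u != s v -> dom (s v) u.
Proof. by move=> uv; apply: (in_sourceP uv).2; rewrite !inE. Qed.

Lemma in_source_id (v : V) : inv v = set0 -> s v = v.
Proof.
by move=> v0; rewrite /in_source; case: pickP => //= x; rewrite v0 inE.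
Qed.

Lemma tau_inN (v : V) : inv v != set0 -> tau dom (inv v) = [set s v].
Proof.
case/set0Pn=> u; rewrite !inE => /= uv; have [sv v_src] := in_sourceP uv.
by apply: tau_source => //; rewrite !inE.
Qed.

Lemma retentiveP (A : {set V}) :
  reflect (A != set0 /\ {in A, forall v, s v \in A})
          (retentive dom [set: V] A).
Proof.
apply: (iffP and3P) => [[A0 _ /forall_inP retA] | [A0 sA]].
  split=> // v vA; have [/in_source_id -> // | v0] := eqVneq (inv v) set0.
  by have := implyP (retA v vA) v0; rewrite tau_inN // sub1set.
split=> //; apply/forall_inP => v vA; apply/implyP => v0.
by rewrite tau_inN // sub1set sA.
Qed.

(** The image [s @: A] is itself a retentive subset of [A]. The equality provides every element of
    [A] with a preimage under [s] in [A]. *)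
Lemma minimal_retentive_imset (A : {set V}) :
  minimal_retentive dom [set: V] A -> s @: A = A.
Proof.
case/minsetP=> /retentiveP[A0 sA] minA.
have sAA : s @: A \subset A by apply/subsetP => _ /imsetP[v vA ->]; apply: sA.
apply: minA => //; apply/retentiveP; split; first by rewrite imset_eq0.
by move=> v /(subsetP sAA) vA; apply: imset_f.
Qed.

(** A nonempty intersection would be retentive, hence equal to both sets by minimality. *)
Lemma minimal_retentive_disjoint (A B : {set V}) :
  minimal_retentive dom [set: V] A -> minimal_retentive dom [set: V] B ->
  A != B -> [disjoint A & B].
Proof.
case/minsetP=> retA minA /minsetP[retB minB]; apply: contraR.
rewrite -setI_eq0 => AB0; have retAB := retentive_setI retA retB AB0.
by rewrite -{1}(minA _ retAB (subsetIl _ _)) (minB _ retAB (subsetIr _ _)).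
Qed.

(** The recurring tool: if [x] and [y] lie in different sets among [A] and [B] and [x] dominates
    [y], then [s y] stays on the side of [y], hence differs from [x] and dominates it. *)
Lemma in_source2_between (A B : {set V}) (v b : V) :
  {in A, forall x, s x \in A} -> s @: B = B -> [disjoint A & B] ->
  v \in A -> b \in B -> dom v b -> dom v (s (s v)) && dom (s (s v)) b.
Proof.
move=> sA sB disAB vA bB vb.
have neqAB x y : x \in A -> y \in B -> x != y.
  by move=> xA yB; apply: contraTneq yB => <-; rewrite (disjointFr disAB).
have sbB : s b \in B by rewrite -sB imset_f.
have svA := sA v vA; have ssvA := sA _ svA.
have dom_antisym x y : dom x y -> dom y x -> False.
  by move=> xy; apply/negP/dom_asym.
(* The in-neighbour of [v] needed here is [s b]. *)
have svv : dom (s v) v.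
  by apply: in_source_dom (in_source_max vb _); apply: neqAB.
have ssv_sv : dom (s (s v)) (s v).
  case/orP: (dom_total (neqAB _ _ svA bB)) => [svb | /in_source_dom //].
  by apply: in_source_dom (in_source_max svb _); apply: neqAB.
(* Otherwise [s (s v)] is an in-neighbour of [v] other than [s v], hence dominated by [s v], against
   [ssv_sv]. *)
have v_ssv : dom v (s (s v)).
  have neq_v : v != s (s v).
    by apply/eqP => eq_v; apply: dom_antisym svv _; rewrite {1}eq_v.
  case/orP: (dom_total neq_v) => // ssv_v.
  have neq_sv : s (s v) != s v by apply: contraTneq ssv_sv => ->; rewrite domxx.
  by case: (dom_antisym _ _ ssv_sv (in_source_max ssv_v neq_sv)).
rewrite v_ssv; case/orP: (dom_total (neqAB _ _ ssvA bB)) => // b_ssv.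
have sv_b : dom (s v) b.
  case/orP: (dom_total (neqAB _ _ svA bB)) => // b_sv.
  have neq_b : b != s (s v) by rewrite eq_sym neqAB.
  by case: (dom_antisym _ _ b_ssv (in_source_max b_sv neq_b)).
(* Under the assumption [b_ssv], the preimage [c] of [b] compares with [v] in neither direction: if
   [v] dominates [c], then [b] dominates [v]; if [c] dominates [v], then [s v] dominates [c], so [b]
   dominates [s v]. *)
have /imsetP[c cB def_b] : b \in s @: B by rewrite sB.
exfalso; case/orP: (dom_total (neqAB _ _ vA cB)) => [vc | cv].
  by apply: dom_antisym vb _; rewrite def_b in_source_max // -def_b neqAB.
have sv_c : dom (s v) c by rewrite in_source_max // eq_sym neqAB.
by apply: dom_antisym sv_b _; rewrite def_b in_source_max // -def_b neqAB.
Qed.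

Lemma minimal_retentive_not_dom (A B : {set V}) (a b : V) :
  minimal_retentive dom [set: V] A -> minimal_retentive dom [set: V] B ->
  A != B -> a \in A -> b \in B -> ~~ dom a b.
Proof.
move=> minA minB neqAB aA bB; apply/negP => ab.
have sA : {in A, forall x, s x \in A}.
  by move=> x xA; rewrite -(minimal_retentive_imset minA) imset_f.
have sB := minimal_retentive_imset minB.
have disAB := minimal_retentive_disjoint minA minB neqAB.
(* Local transitivity at [b] provides a sink [x]; yet [s (s x)] lies in this same set and is
   dominated by [x]. *)
have trAb : transitive_on dom (A :&: inv b).
  move=> x y z /setIP[_ xb] /setIP[_ yb] /setIP[_ zb].
  exact: (locally_transitive_dom b).2.
have Ab0 : A :&: inv b != set0 by apply/set0Pn; exists a; rewrite !inE aA.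
have [x /setIP[xA]] := transitive_on_sink trAb Ab0.
rewrite !inE /= => xb x_sink.
have /andP[x_ssx ssx_b] := in_source2_between sA sB disAB xA bB xb.
by have := x_sink (s (s x)); rewrite x_ssx !inE !sA // ssx_b => /(_ isT).
Qed.

(** If the sets differed, they would be disjoint, and elements [a] and [b] taken from each would be
    distinct with neither dominating the other. *)
Lemma minimal_retentive_inj (A B : {set V}) :
  minimal_retentive dom [set: V] A -> minimal_retentive dom [set: V] B -> A = B.
Proof.
move=> minA minB; apply/eqP; apply/idPn => neqAB.
have disAB := minimal_retentive_disjoint minA minB neqAB.
have [/retentiveP[/set0Pn[a aA] _] _] := minsetP minA.
have [/retentiveP[/set0Pn[b bB] _] _] := minsetP minB.
have neq_ab : a != b by apply: contraTneq bB => <-; rewrite (disjointFr disAB).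
have /negbTE n_ab := minimal_retentive_not_dom minA minB neqAB aA bB.
rewrite eq_sym in neqAB.
have /negbTE n_ba := minimal_retentive_not_dom minB minA neqAB bB aA.
by have := dom_total neq_ab; rewrite n_ab n_ba.
Qed.

End Sources.

Theorem theorem8 (V : finType) (dom : rel V)
    (tournament_dom : tournament dom)
    (locally_transitive_dom : locally_transitive dom) :
  exists! A : {set V}, minimal_retentive dom [set: V] A.
Proof.
(* Existence: the whole vertex set is retentive, so it contains a minimal retentive set. *)
have retT : retentive dom [set: V] [set: V].
  apply/and3P; split=> //; last by apply/forall_inP => v _; rewrite subsetT implybT.
  by rewrite -card_gt0 cardsT; case: tournament_dom.
have [A minA _] := minset_exists retT.
by exists A; split=> // B; apply: minimal_retentive_inj.
Qed.
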